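(* Let $r\geq 2$, $n\geq r$ and $m\geq t_r(n)$, and let $G$ be any graph with $n$ vertices and $m$ edges. Then: (i) every $\mathfrak{P}$-sequence of $G$ has at least $r$ terms; (ii) for every $\mathfrak{P}$-sequence $v_1,\dots,v_k$ of $G$ (so $k\ge r$), its first $r$ terms satisfy $\sum_{i=1}^{r} d(v_i)\geq (r-1)n$; (iii) if equality $\sum_{i=1}^{r} d(v_i)=(r-1)n$ holds for the first $r$ terms $v_1,\dots,v_r$ of some $\mathfrak{P}$-sequence of $G$, then $m=t_r(n)$.
   Context: Graphs are finite and simple. $d(u)$ denotes the degree of a vertex $u$ and $\Gamma(u)$ its neighbourhood; for a set $U$ of vertices, $\widehat{\Gamma}(U)=\bigcap_{v\in U}\Gamma(v)$ is the common neighbourhood. $T_r(n)$ is the $r$-partite Turán graph on $n$ vertices (complete $r$-partite graph with part sizes differing by at most one) and $t_r(n)$ is its number of edges. The greedy algorithm $\mathfrak{P}$ constructs a clique $v_1,\dots,v_k$ in a graph $G$ as follows: $v_1$ is a vertex of maximum degree in $G$; having selected $v_1,\dots,v_{i-1}$, if $\widehat{\Gamma}(\{v_1,\dots,v_{i-1}\})=\varnothing$ the algorithm stops, otherwise it selects $v_i$ to be a vertex of maximum degree (degree in $G$) among the vertices of $\widehat{\Gamma}(\{v_1,\dots,v_{i-1}\})$, and repeats. Since ties may be broken arbitrarily, the output need not be unique; any sequence that can be produced by $\mathfrak{P}$ is called a $\mathfrak{P}$-sequence. *)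

(* Defs.v *)
From mathcomp Require Import all_boot.

Set Implicit Arguments.
Unset Strict Implicit.
Unset Printing Implicit Defensive.

Definition simple_graph (T : finType) (e : rel T) : Prop :=
  symmetric e /\ irreflexive e.

Section Graph.
Variables (T : finType) (e : rel T).
Implicit Types (u v : T) (U : {set T}) (s : seq T).

Definition edges : {set {set T}} := [set [set p.1; p.2] | p : T * T & e p.1 p.2].

Definition nbhd u : {set T} := [set v | e u v].

Definition degree u : nat := #|nbhd u|.

(* As for any intersection of subsets of T, common_nbhd set0 = setT. *)
Definition common_nbhd U : {set T} := \bigcap_(v in U) nbhd v.

(* The states reachable by the greedy algorithm, finished or not. Since
   common_nbhd set0 = setT, the first selection is covered by greedy_step:
   it is a vertex of maximum degree in the whole graph. *)
Inductive greedy_run : seq T -> Prop :=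
| greedy_start : greedy_run [::]
| greedy_step s v :
    greedy_run s ->
    v \in common_nbhd [set u in s] ->
    (forall u, u \in common_nbhd [set u in s] -> degree u <= degree v) ->
    greedy_run (rcons s v).

(* The possible outputs are the runs at which the algorithm stops. *)
Definition P_sequence s : Prop :=
  greedy_run s /\ common_nbhd [set u in s] = set0.

End Graph.

(* The parts are the residue classes mod r, whose sizes in {0, ..., n-1} differ
   by at most one. *)
Definition turan_graph (r n : nat) : rel 'I_n := fun i j => i %% r != j %% r.

Definition turan_number (r n : nat) : nat := #|edges (@turan_graph r n)|.

(* Main.v *)
Require Import Defs.
From mathcomp Require Import all_boot zify.

(** Let [d_i] be the degree of [v_i]. Assigning each vertex [u] to the first
    [v_i] not adjacent to it (or to [v_r] if [v_1, ..., v_{r-1}] are all adjacent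
    to [u]) splits the vertices into classes of sizes [b_i], with [d u <= d_i]
    on the [i]-th class and [b_i + d_i <= n] for [i < r]. If the sum of the [d_i]
    is at most [(r-1)n], weight can be moved from [v_r] to the [v_i] of larger
    degree until the condition holds for [i = r] too, and then
    [2m <= sum a_i d_i <= sum a_i (n - a_i)] with [sum a_i = n], which is at
    most [2 t_r(n)]. The last bound, with its strictness, is obtained from
    the tangent inequality [(x - q)(x - q - 1) >= 0] at [q = n %/ r], an equality
    on the class sizes of the Turán graph. *)

Set Implicit Arguments.
Unset Strict Implicit.
Unset Printing Implicit Defensive.

(** * Degree sums and edge counts *)

Lemma card_related_pairs (T : finType) (e : rel T) :
  #|[set p : T * T | e p.1 p.2]| = \sum_u degree e u.
Proof.
have degE u : degree e u = \sum_(v | e u v) 1.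
  by rewrite /degree -sum1_card; apply: eq_bigl => v; rewrite inE.
rewrite (eq_bigr _ (fun u _ => degE u)) pair_big_dep /= -sum1_card.
by apply: eq_bigl => p; rewrite inE.
Qed.

Lemma set2_eq (T : finType) (x y u v : T) :
  ([set u; v] == [set x; y]) = ((u, v) == (x, y)) || ((u, v) == (y, x)).
Proof.
apply/eqP/idP => [Exy | /orP[]/eqP[-> ->] //]; last by rewrite setUC.
have: u \in [set x; y] by rewrite -Exy !inE eqxx.
have: v \in [set x; y] by rewrite -Exy !inE eqxx orbT.
have: x \in [set u; v] by rewrite Exy !inE eqxx.
have: y \in [set u; v] by rewrite Exy !inE eqxx orbT.
rewrite !inE !xpair_eqE (eq_sym x) (eq_sym x v) (eq_sym y) (eq_sym y v).
by case: (u == x); case: (u == y); case: (v == x); case: (v == y).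
Qed.

(** The map [(x, y)] to [{x, y}] on adjacent ordered pairs is exactly two-to-one: irreflexivity
    makes the two orders distinct, symmetry makes both of them adjacent. *)
Lemma handshake (T : finType) (e : rel T) :
  simple_graph e -> \sum_u degree e u = 2 * #|edges e|.
Proof.
case=> e_sym e_irr; rewrite -card_related_pairs.
have -> : edges e = (fun p : T * T => [set p.1; p.2]) @: [set p | e p.1 p.2].
  by apply/setP => A; apply/imsetP/imsetP => -[p]; rewrite ?inE => ep ->;
    exists p; rewrite ?inE.
rewrite -sum1_card (partition_big_imset (fun p : T * T => [set p.1; p.2])) /=.
rewrite mulnC -sum_nat_const; apply: eq_bigr => _ /imsetP[[x y] exy ->] /=.
rewrite inE /= in exy; have xy : x != y by apply: contraTneq exy => ->; rewrite e_irr.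
rewrite sum1_card -(_ : #|[set (x, y); (y, x)]| = 2); last first.
  by rewrite cards2 xpair_eqE (negPf xy).
apply: eq_card => -[u v]; rewrite -topredE /= !inE /= set2_eq.
case: eqP => [[-> ->]|_] /=; first by rewrite exy.
by case: eqP => [[-> ->]|_]; rewrite ?andbF // e_sym exy.
Qed.

(** * Edges of the Turán graph *)

(** Each of the [q] full periods meets the residue [c] once, and the last [t] numbers meet it once
    more when [c < t]. *)
Lemma sum_modn_eq (r c q t : nat) : c < r -> t <= r ->
  \sum_(i < q * r + t) (i %% r == c) = q + (c < t).
Proof.
move=> c_lt; elim: q t => [|q IHq]; elim=> [|t IHt] t_le.
- by rewrite big_ord0.
- by rewrite addnS big_ord_recr /= IHt ?(ltnW t_le) // mul0n modn_small //; lia.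
- by rewrite addn0 mulSn addnC IHq // c_lt; lia.
- rewrite addnS big_ord_recr /= IHt ?(ltnW t_le) // modnMDl modn_small //; lia.
Qed.

(** The degree sum is [n ^ 2] minus the sum of the squared part sizes [N c]. As [N c] is [q] or
    [q + 1], [(N c - q)(N c - q - 1) = 0] turns these squares into linear terms. *)
Lemma turan_number_ge (r n : nat) (q := n %/ r) : 0 < r ->
  n ^ 2 + r * (q * q.+1) <= 2 * turan_number r n + n * (2 * q + 1).
Proof.
move=> r_gt0.
have turan_simple : simple_graph (@turan_graph r n).
  by split=> [i j|i]; rewrite /turan_graph ?eqxx // eq_sym.
rewrite /turan_number -handshake //.
pose N c := \sum_(i < n) (i %% r == c).
have degE (i : 'I_n) : degree (@turan_graph r n) i + N (i %% r) = n.
  rewrite /degree -sum1_card big_mkcond -big_split /= -[RHS]card_ord -sum1_card.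
  by apply: eq_bigr => j _; rewrite inE /turan_graph eq_sym; case: eqP.
have sumN (f : nat -> nat) : \sum_(i < n) f (i %% r) = \sum_(c < r) N c * f c.
  under [RHS]eq_bigr do rewrite big_distrl.
  rewrite exchange_big; apply: eq_bigr => i _ /=.
  rewrite (bigD1 (Ordinal (ltn_pmod i r_gt0))) //= eqxx mul1n big1 ?addn0 //.
  by move=> c; rewrite -val_eqE eq_sym /= => /negPf->.
have NE (c : 'I_r) : N c = q \/ N c = q.+1.
  have := sum_modn_eq q (ltn_ord c) (ltnW (ltn_pmod n r_gt0)).
  rewrite -divn_eq -/(N c) => ->.
  by case: (c < _); [right; rewrite addn1 | left; rewrite addn0].
have N2 : \sum_(c < r) N c * N c + r * (q * q.+1) = n * (2 * q + 1).
  have -> : n * (2 * q + 1) = \sum_(c < r) N c * (2 * q + 1).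
    by rewrite -(sumN (fun=> 2 * q + 1)) sum_nat_const card_ord.
  rewrite -[X in X * (q * _)]card_ord -sum_nat_const -big_split.
  by apply: eq_bigr => c _ /=; case: (NE c) => ->; lia.
have := sumN N; rewrite -N2 => <-.
rewrite addnA -big_split /=; under eq_bigr do rewrite degE.
by rewrite sum_nat_const card_ord -mulnn.
Qed.

(** * Weights on a sequence *)

Lemma sum_update (T : eqType) (s : seq T) (x : T) (F : T -> nat -> nat)
    (a : T -> nat) (k : nat) :
  x \notin s ->
  \sum_(y <- s) F y (if y == x then k else a y) = \sum_(y <- s) F y (a y).
Proof.
move=> xs; apply: eq_big_seq => y ys; case: eqP => // yx.
by rewrite yx (negPf xs) in ys.
Qed.

Lemma sum_interpolation (T : eqType) (s : seq T) (b c : T -> nat) (M : nat) :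
  uniq s -> {in s, forall x, b x <= c x} ->
  \sum_(x <- s) b x <= M <= \sum_(x <- s) c x ->
  exists2 a : T -> nat, {in s, forall x, b x <= a x <= c x} &
    \sum_(x <- s) a x = M.
Proof.
elim: s M => [|x s IHs] M.
  by rewrite !big_nil leqn0 => _ _ /eqP->; exists b; rewrite ?big_nil.
move=> /= /andP[xs s_uniq] bc; rewrite !big_cons => /andP[bM cM].
have bcx := bc x (mem_head x s).
have bcs : {in s, forall y, b y <= c y} by move=> y ys; apply: bc; rewrite inE ys orbT.
have sum_bc : \sum_(y <- s) b y <= \sum_(y <- s) c y.
  by rewrite !big_seq; apply: leq_sum => y; apply: bcs.
(* The head takes as much of [M] as its upper bound allows while leaving the lower bounds for the
   tail. *)
pose k := minn (c x) (M - \sum_(y <- s) b y).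
have [|a ac aM] := IHs (M - k) s_uniq bcs; first by rewrite /k; lia.
exists (fun y => if y == x then k else a y) => [y|].
  rewrite inE; case: eqP => [-> _|_ /= /ac //]; rewrite /k; lia.
rewrite big_cons eqxx (sum_update (fun _ => id)) // aM /k; lia.
Qed.

(** Termwise, [a x * d x <= a x * (n - a x)], and the tangent inequality bounds the square. The
    boolean summand records a gain of one: if the [d x] sum to less than [(size s - 1) * n], some
    [a x + d x] is below [n]. *)
Lemma sum_weighted_le (T : eqType) (s : seq T) (a d : T -> nat) (n q : nat) :
  0 < q -> {in s, forall x, a x + d x <= n} -> \sum_(x <- s) a x = n ->
  \sum_(x <- s) a x * d x + n * (2 * q + 1)
    + (n + \sum_(x <- s) d x < size s * n)
  <= n ^ 2 + size s * (q * q.+1).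
Proof.
move=> q_gt0 ad sum_a.
have step x : x \in s ->
    a x * d x + a x * (2 * q + 1) + (a x + d x < n) <= a x * n + q * q.+1.
  move=> /ad adx; have [k ->] : exists k, n = a x + d x + k.
    by exists (n - (a x + d x)); lia.
  have tangent : a x * (2 * q + 1) <= a x * a x + q * q.+1.
    by case: (leqP (a x) q) => [/subnK<-|/subnK<-]; nia.
  (* A deficit [k > 0] gains [a x * k]; when [a x = 0], the unit comes from [q * q.+1 > 0]
     instead. *)
  by case: (posnP (a x)) => [->|]; nia.
have size_sum k : \sum_(x <- s) k = size s * k.
  by rewrite big_const_seq count_predT iter_addn_0 mulnC.
have slack : (n + \sum_(x <- s) d x < size s * n)
    <= \sum_(x <- s) (a x + d x < n).
  case: ltnP => // lt_n; rewrite lt0n; apply: contraTneq lt_n => sum0.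
  rewrite -leqNgt -sum_a -size_sum -big_split sum_a /=.
  rewrite big_seq [X in _ <= X]big_seq; apply: leq_sum => x xs.
  move/eqP: sum0; rewrite sum_nat_seq_eq0 => /allP/(_ x xs) /=; lia.
have : \sum_(x <- s) (a x * d x + a x * (2 * q + 1) + (a x + d x < n))
    <= \sum_(x <- s) (a x * n + q * q.+1).
  by rewrite big_seq [X in _ <= X]big_seq; apply: leq_sum.
rewrite !big_split /= -!big_distrl /= sum_a size_sum -mulnn; lia.
Qed.

(** * Greedy runs and their degree sums *)

Section Greedy.
Variables (T : finType) (e : rel T).
Local Notation cn s := (common_nbhd e [set u in s]).
Local Notation d := (degree e).

Lemma mem_common_nbhd (s : seq T) (v : T) :
  (v \in cn s) = all (fun u => e u v) s.
Proof.
apply/bigcapP/allP => [sv u us|sv u]; last by rewrite !inE; apply: sv.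
by have := sv u; rewrite !inE; apply.
Qed.

Lemma common_nbhd_rcons (s : seq T) (v : T) : cn (rcons s v) = cn s :&: nbhd e v.
Proof. by apply/setP => u; rewrite inE !mem_common_nbhd all_rcons inE andbC. Qed.

Lemma greedy_run_rcons (s : seq T) (v : T) : greedy_run e (rcons s v) ->
  [/\ greedy_run e s, v \in cn s & {in cn s, forall u, d u <= d v}].
Proof.
move=> run; inversion run as [E|s' v' ? ? ? E]; first by case: s {run} E.
by case/rcons_inj: E => <- <-.
Qed.

Lemma greedy_run_cat (s1 s2 : seq T) : greedy_run e (s1 ++ s2) -> greedy_run e s1.
Proof.
elim/last_ind: s2 => [|s2 v IHs]; rewrite ?cats0 // -rcons_cat.
by case/greedy_run_rcons => /IHs.
Qed.

Hypothesis e_irr : irreflexive e.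

Lemma greedy_run_uniq (s : seq T) : greedy_run e s -> uniq s.
Proof.
elim=> {s} // s v _ s_uniq; rewrite mem_common_nbhd rcons_uniq s_uniq andbT => sv _.
by apply/negP => /(allP sv); rewrite e_irr.
Qed.

(** Common neighbourhoods shrink along a run, so [w] was already a candidate when [u] was
    selected. *)
Lemma greedy_run_degree (s : seq T) : greedy_run e s ->
  {in s & cn s, forall u w, d w <= d u}.
Proof.
elim=> {s} // s v _ IHs _ v_max u w.
rewrite common_nbhd_rcons mem_rcons !inE => /orP[/eqP-> | us] /andP[ws _].
  exact: v_max.
exact: IHs.
Qed.

(** Take for [b v] the number of vertices that leave the common neighbourhood when [v] is selected.
    They are non-neighbours of [v], and they were candidates beside [v], hence of degree at most
    [d v]. *)
Lemma greedy_run_weights (s : seq T) : greedy_run e s ->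
  exists b : T -> nat,
    [/\ {in s, forall v, b v + d v <= #|T|},
        \sum_(v <- s) b v + #|cn s| = #|T| &
        \sum_(u in ~: cn s) d u <= \sum_(v <- s) b v * d v].
Proof.
elim=> {s} [|s v run [b [b_le b_sum b_deg]] vs v_max].
  have -> : cn [::] = setT by apply/setP => u; rewrite mem_common_nbhd inE.
  exists (fun=> 0); split=> //; rewrite big_nil ?cardsT //.
  by rewrite setCT big_set0.
have v_notin : v \notin s.
  by have := greedy_run_uniq (greedy_step run vs v_max); rewrite rcons_uniq => /andP[].
exists (fun y => if y == v then #|cn s :\: nbhd e v| else b y).
rewrite common_nbhd_rcons !big_rcons /= eqxx.
rewrite (sum_update (fun _ => id)) // (sum_update (fun y k => k * d y)) //.
split=> [y||].
- rewrite mem_rcons inE; case: eqP => [-> _|_ /= /b_le //].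
  rewrite -(cardsC (nbhd e v)) addnC leq_add2l subset_leq_card //.
  by rewrite setDE subsetIr.
- by rewrite -b_sum -(cardsID (nbhd e v) (cn s)) -addnA [_ + #|cn s :&: _|]addnC.
- rewrite (big_setID (~: cn s)) /=.
  have -> : ~: (cn s :&: nbhd e v) :&: ~: cn s = ~: cn s.
    by rewrite setCI setUK.
  have -> : ~: (cn s :&: nbhd e v) :\: ~: cn s = cn s :\: nbhd e v.
    by apply/setP => u; rewrite !inE; case: (u \in cn s); rewrite ?andbF ?andbT.
  apply: leq_add b_deg _; rewrite -sum_nat_const.
  by apply: leq_sum => u /setDP[/v_max].
Qed.

(** When the algorithm stops, the classes of sizes [b v] exhaust the vertices, so these sizes serve
    directly as weights. *)
Lemma P_sequence_sum_degree (s : seq T) (q : nat) (n := #|T|) :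
  P_sequence e s -> 0 < q ->
  \sum_u d u + n * (2 * q + 1) <= n ^ 2 + size s * (q * q.+1).
Proof.
case=> run cn0 q_gt0; have [b [b_le]] := greedy_run_weights run.
rewrite cn0 setC0 cards0 addn0 => b_sum b_deg.
apply: leq_trans (leq_trans (leq_addr _ _) (sum_weighted_le q_gt0 b_le b_sum)).
by rewrite leq_add2r (eq_bigl (fun u => u \in [set: T])) // => u; rewrite inE.
Qed.

Lemma greedy_run_sum_degree (s : seq T) (v : T) (q : nat) (n := #|T|) :
  greedy_run e (rcons s v) -> 0 < q ->
  \sum_(u <- rcons s v) d u <= size s * n ->
  \sum_u d u + n * (2 * q + 1) + (\sum_(u <- rcons s v) d u < size s * n)
  <= n ^ 2 + (size s).+1 * (q * q.+1).
Proof.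
move=> run_sv q_gt0; rewrite big_rcons /= => d_sum.
have := greedy_run_uniq run_sv; rewrite rcons_uniq => /andP[v_notin s_uniq].
have [run vs v_max] := greedy_run_rcons run_sv.
have [b [b_le b_sum b_deg]] := greedy_run_weights run.
have dn u : d u <= n by apply: max_card.
have size_sum : \sum_(u <- s) d u + \sum_(u <- s) (n - d u) = size s * n.
  rewrite -big_split /= (eq_bigr (fun=> n)) => [|u _]; last by rewrite subnKC.
  by rewrite big_const_seq count_predT iter_addn_0 mulnC.
have b_le_n : {in s, forall u, b u <= n - d u} by move=> u /b_le; rewrite -/n; lia.
(* [M] is the weight given to [s] after the shift: [v] keeps [n - M <= n - d v]. The assumed bound
   on the degree sum says that [d v] fits under the total capacity of [s], the sum of the
   [n - d u]. *)
pose M := maxn (\sum_(u <- s) b u) (d v).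
have [|a a_bd a_sum] := @sum_interpolation _ s b (fun u => n - d u) M s_uniq b_le_n.
  rewrite leq_maxl /= geq_max; apply/andP; split; last by lia.
  by rewrite !big_seq; apply: leq_sum.
pose a' y := if y == v then n - M else a y.
have M_le : M <= n by rewrite geq_max dn andbT /n -b_sum leq_addr.
have a'_le : {in rcons s v, forall u, a' u + d u <= n}.
  move=> u; rewrite mem_rcons inE /a'; case: eqP => [-> _|_ /= /a_bd].
    by rewrite /M in M_le *; lia.
  by have := dn u; lia.
have a'_sum : \sum_(u <- rcons s v) a' u = n.
  by rewrite big_rcons /= /a' eqxx (sum_update (fun _ => id)) // a_sum; lia.
have := sum_weighted_le q_gt0 a'_le a'_sum.
rewrite !big_rcons /= size_rcons /a' eqxx (sum_update (fun y k => k * d y)) //.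
have cn_deg : \sum_(u in cn s) d u <= #|cn s| * d v.
  by rewrite -sum_nat_const; apply: leq_sum => u /v_max.
have all_deg : \sum_u d u = \sum_(u in cn s) d u + \sum_(u in ~: cn s) d u.
  by rewrite (bigID (mem (cn s))) /=; congr (_ + _); apply: eq_bigl => u; rewrite !inE.
(* Subtraction-free form of: the sum of [(a u - b u) * (d u - d v)] is nonnegative, so the shift
   does not lower the weighted degree sum. *)
have exchange : \sum_(u <- s) b u * d u + (\sum_(u <- s) a u) * d v
    <= \sum_(u <- s) a u * d u + (\sum_(u <- s) b u) * d v.
  rewrite !big_distrl -!big_split /= !big_seq; apply: leq_sum => u us.
  have /andP[/subnK<- _] := a_bd u us.
  have := greedy_run_degree run us vs; nia.
rewrite a_sum in exchange.
have total : #|cn s| * d v + (\sum_(u <- s) b u) * d v = (n - M) * d v + M * d v.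
  by rewrite -!mulnDl addnC b_sum subnK.
have deg_le : \sum_u d u <= \sum_(u <- s) a u * d u + (n - M) * d v by lia.
have -> : (n + (\sum_(u <- s) d u + d v) < (size s).+1 * n)
    = (\sum_(u <- s) d u + d v < size s * n) by rewrite mulSn ltn_add2l.
by apply: leq_trans; rewrite !leq_add2r.
Qed.

End Greedy.

Theorem theorem1 (r n m : nat) (T : finType) (e : rel T)
    (r_ge2 : 2 <= r) (n_ge_r : r <= n) (m_ge : turan_number r n <= m)
    (e_simple : simple_graph e) (card_vertices : #|T| = n)
    (card_edges : #|edges e| = m) :
  [/\ forall s : seq T, P_sequence e s -> r <= size s,
      forall s : seq T, P_sequence e s ->
        (r - 1) * n <= \sum_(v <- take r s) degree e v
    & (exists2 s : seq T, P_sequence e s &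
         \sum_(v <- take r s) degree e v = (r - 1) * n) ->
      m = turan_number r n].
Proof.
have r_gt0 : 0 < r by lia.
have q_gt0 : 0 < n %/ r by rewrite divn_gt0.
have e_irr := e_simple.2.
have turan_ge := turan_number_ge n r_gt0.
have degrees := handshake e_simple; rewrite card_edges in degrees.
have size_ge s : P_sequence e s -> r <= size s.
  move=> /(P_sequence_sum_degree e_irr)/(_ q_gt0).
  (* A shorter sequence would lose at least one positive summand [q * q.+1], with [q = n %/ r], and
     force [m] below the Turán number. *)
  rewrite card_vertices degrees => bound; rewrite leqNgt; apply/negP => s_lt.
  have : (size s).+1 * (n %/ r * (n %/ r).+1) <= r * (n %/ r * (n %/ r).+1).
    by rewrite leq_mul2r s_lt orbT.
  rewrite mulSn; nia.
(* This gives both (ii) and (iii): a sum below [(r - 1) * n] would force [m < turan_number r n], and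
   equality forces [m <= turan_number r n]. Halving the doubled bound keeps the boolean unit, since
   [2m + 1 <= 2t] implies [m + 1 <= t]. *)
have bound s : P_sequence e s ->
    \sum_(v <- take r s) degree e v <= (r - 1) * n ->
    m + (\sum_(v <- take r s) degree e v < (r - 1) * n) <= turan_number r n.
  move=> sP; have := size_ge s sP; have run := sP.1.
  rewrite -[s in greedy_run e s](cat_take_drop r) in run.
  have := greedy_run_cat run => {}run r_le.
  have : size (take r s) = r by rewrite size_takel.
  case/lastP: (take r s) run => [|s' v] run; first by move=> /= E; lia.
  rewrite size_rcons => sr; have -> : r - 1 = size s' by lia.
  have := greedy_run_sum_degree e_irr run q_gt0.
  rewrite card_vertices degrees sr => /[apply]; lia.
split=> // [s sP|[s sP sum_eq]].
  by rewrite leqNgt; apply/negP => lt_sum; have := bound s sP (ltnW lt_sum); lia.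
by have := bound s sP; rewrite sum_eq leqnn => /(_ isT); lia.
Qed.
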